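(* Let $\mathscr A$ be a small category and $n$ a non-negative integer. The following structures on $\mathscr A$ are equivalent (giving one of them amounts to giving any of the others): 1. a $\mathcal P(\underline n)$-module structure on $\mathscr A$; 2. a family of $n$ strict idempotent comonads $(\mathbb K_1,\dots,\mathbb K_n)$ on $\mathscr A$, $\mathbb K_i=(K_i,\Delta_i,\epsilon_i)$, whose underlying endofunctors commute under composition, i.e. $K_iK_k=K_kK_i$ for all $1\le i,k\le n$; 3. a family of $n$ strict coreflective subcategories of $\mathscr A$, $\{R_i:\mathscr A\to\mathscr A_i\}_{i=1}^n$, such that $R_i|_{\mathscr A_k}R_k=R_k|_{\mathscr A_i}R_i$ for all $1\le i,k\le n$.
   Context: $\underline n=\{1,\dots,n\}$, and $\mathcal P(\underline n)$ is the poset category of subsets of $\underline n$ (morphisms are inclusions), with symmetric monoidal structure $\cap$ and unit $\underline n$. A $\mathcal P(\underline n)$-module structure on a category $\mathscr A$ is a functor $\theta:\mathscr A\times\mathcal P(\underline n)\to\mathscr A$ such that $\theta(-,\underline n)=\mathrm{Id}_{\mathscr A}$ and $\theta(\theta(-,U),V)=\theta(-,U\cap V)$ for all $U,V\subseteq\underline n$ (i.e. $\theta\circ(\theta\times\mathrm{Id})=\theta\circ(\mathrm{Id}\times\cap)$ as functors). A comonad $(K,\Delta,\epsilon)$ on $\mathscr A$ consists of an endofunctor $K$ with comultiplication $\Delta:K\Rightarrow KK$ and counit $\epsilon:K\Rightarrow\mathrm{Id}_{\mathscr A}$ satisfying coassociativity and counitality. It is strict idempotent if $\Delta$ is the identity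 (so $KK=K$). A coreflective subcategory of $\mathscr A$ is a full subcategory $\mathscr A_0\subseteq\mathscr A$ whose inclusion $\iota$ admits a right adjoint $R:\mathscr A\to\mathscr A_0$ (the adjunction being part of the data). It is strict if the unit $a\to R\iota a$, $a\in\mathscr A_0$, is the identity. In item 3, both composites are regarded as functors $\mathscr A\to\mathscr A$ via the inclusions. *)

(* Defs.v *)
From mathcomp Require Import all_boot.

Set Implicit Arguments.
Unset Strict Implicit.
Unset Printing Implicit Defensive.

(* Small categories.  Objects and morphisms are compared with Leibniz equality,
   so that strict identities between functors, such as [K K = K], are
   meaningful. *)
Record category : Type := Category {
  ob :> Type;
  hom : ob -> ob -> Type;
  idm : forall a, hom a a;
  cmp : forall a b c, hom b c -> hom a b -> hom a c;
  cmp_idl : forall a b (f : hom a b), cmp (idm b) f = f;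
  cmp_idr : forall a b (f : hom a b), cmp f (idm a) = f;
  cmpA : forall a b c d (h : hom c d) (g : hom b c) (f : hom a b),
    cmp h (cmp g f) = cmp (cmp h g) f }.

Arguments hom {_} a b.
Arguments idm {_} a.
Arguments cmp {_ _ _ _} g f.

Declare Scope cat_scope.
Delimit Scope cat_scope with cat.
Local Open Scope cat_scope.

Notation "g \c f" := (cmp g f) (at level 40, left associativity) : cat_scope.

Record functor (C D : category) : Type := Functor {
  fob :> C -> D;
  fmap : forall a b, hom a b -> hom (fob a) (fob b);
  fmap_id : forall a, fmap (idm a) = idm (fob a);
  fmap_cmp : forall a b c (g : hom b c) (f : hom a b),
    fmap (g \c f) = fmap g \c fmap f }.

Arguments fmap {C D} F {a b} f : rename.

Definition idF (C : category) : functor C C :=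
  @Functor C C id (fun _ _ f => f) (fun _ => erefl) (fun _ _ _ _ _ => erefl).

Section CompF.
Variables (C D E : category) (G : functor D E) (F : functor C D).

Lemma compF_id a : fmap G (fmap F (idm a)) = idm (G (F a)).
Proof. by rewrite !fmap_id. Qed.

Lemma compF_cmp a b c (g : hom b c) (f : hom a b) :
  fmap G (fmap F (g \c f)) = fmap G (fmap F g) \c fmap G (fmap F f).
Proof. by rewrite !fmap_cmp. Qed.

Definition compF : functor C E := Functor compF_id compF_cmp.
End CompF.

Notation "G \of F" := (compF G F) (at level 40, left associativity) : cat_scope.

Record nattrans (C D : category) (F G : functor C D) : Type := NatTrans {
  ntc :> forall a, hom (F a) (G a);
  nt_natural : forall a b (f : hom a b), ntc b \c fmap F f = fmap G f \c ntc a }.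

Lemma idN_natural (C D : category) (F : functor C D) a b (f : hom a b) :
  idm (F b) \c fmap F f = fmap F f \c idm (F a).
Proof. by rewrite cmp_idl cmp_idr. Qed.

Definition idN (C D : category) (F : functor C D) : nattrans F F :=
  NatTrans (@idN_natural C D F).

(* The identity transformation between two equal functors. *)
Definition eqN (C D : category) (F G : functor C D) (e : F = G) :
  nattrans F G := let: erefl := e in idN F.

Definition is_identity (C D : category) (F G : functor C D)
  (t : nattrans F G) : Prop := exists e : F = G, t = eqN e.

(* Morphisms together with their endpoints: used to compare morphisms whose
   endpoints are equal but not convertible. *)
Definition arrow (C : category) : Type := {x : C * C & hom x.1 x.2}.

Definition arr (C : category) (a b : C) (f : hom a b) : arrow C :=
  existT (fun x : C * C => hom x.1 x.2) (a, b) f.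

Section Product.
Variables C D : category.

Let phom (x y : C * D) : Type := (hom x.1 y.1 * hom x.2 y.2)%type.
Let pidm (x : C * D) : phom x x := (idm x.1, idm x.2).
Let pcmp (x y z : C * D) (g : phom y z) (f : phom x y) : phom x z :=
  (g.1 \c f.1, g.2 \c f.2).

Lemma prod_idl x y (f : phom x y) : pcmp (pidm y) f = f.
Proof. by case: f => f g; rewrite /pcmp /= !cmp_idl. Qed.

Lemma prod_idr x y (f : phom x y) : pcmp f (pidm x) = f.
Proof. by case: f => f g; rewrite /pcmp /= !cmp_idr. Qed.

Lemma prod_cmpA x y z t (h : phom z t) (g : phom y z) (f : phom x y) :
  pcmp h (pcmp g f) = pcmp (pcmp h g) f.
Proof. by rewrite /pcmp /= !cmpA. Qed.

Definition prodC : category := Category prod_idl prod_idr prod_cmpA.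
End Product.

Section ProductFunctors.
Variables C C' D D' E : category.

Section Pair.
Variables (F : functor C D) (F' : functor C' D').

Let pob (x : prodC C C') : prodC D D' := (F x.1, F' x.2).
Let pmap (x y : prodC C C') (f : hom x y) : hom (pob x) (pob y) :=
  (fmap F f.1, fmap F' f.2).

Lemma prodF_id x : pmap (idm x) = idm (pob x).
Proof. by rewrite /pmap /= !fmap_id. Qed.

Lemma prodF_cmp x y z (g : hom y z) (f : hom x y) :
  pmap (g \c f) = pmap g \c pmap f.
Proof. by rewrite /pmap /= !fmap_cmp. Qed.

Definition prodF : functor (prodC C C') (prodC D D') :=
  Functor prodF_id prodF_cmp.
End Pair.

Definition assocF : functor (prodC (prodC C D) E) (prodC C (prodC D E)) :=
  @Functor (prodC (prodC C D) E) (prodC C (prodC D E))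
    (fun x => (x.1.1, (x.1.2, x.2)))
    (fun _ _ f => (f.1.1, (f.1.2, f.2)))
    (fun _ => erefl) (fun _ _ _ _ _ => erefl).

Section Fix2.
Variables (T : functor (prodC C D) E) (d : D).

Let sob (c : C) : E := T (c, d).
Let smap (a b : C) (f : hom a b) : hom (sob a) (sob b) :=
  @fmap _ _ T (a, d) (b, d) (f, idm d).

Lemma fix2_id a : smap (idm a) = idm (sob a).
Proof. exact: (fmap_id T (a, d)). Qed.

Lemma fix2_cmp a b c (g : hom b c) (f : hom a b) :
  smap (g \c f) = smap g \c smap f.
Proof. by rewrite /smap -fmap_cmp /= cmp_idl. Qed.

(* [fix2 T d] is the functor T(-, d). *)
Definition fix2 : functor C E := Functor fix2_id fix2_cmp.
End Fix2.

End ProductFunctors.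

Arguments assocF C D E : clear implicits.

(* The poset of subsets of an n-element set, with ['I_n = {0, ..., n - 1}]
   in the role of {1, ..., n}. *)
Section Powerset.
Variable n : nat.
Implicit Types U V W : {set 'I_n}.

Let phom U V : Prop := U \subset V.
Let pidm U : phom U U := subxx U.
Let pcmp U V W (g : phom V W) (f : phom U V) : phom U W := subset_trans f g.

Definition powC : category :=
  @Category {set 'I_n} phom pidm pcmp
    (fun _ _ _ => bool_irrelevance _ _) (fun _ _ _ => bool_irrelevance _ _)
    (fun _ _ _ _ _ _ _ => bool_irrelevance _ _).

Definition capF : functor (prodC powC powC) powC :=
  @Functor (prodC powC powC) powC (fun x => x.1 :&: x.2)
    (fun _ _ f => setISS f.1 f.2)
    (fun _ => bool_irrelevance _ _) (fun _ _ _ _ _ => bool_irrelevance _ _).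
End Powerset.

Record pow_module (A : category) (n : nat) : Type := PowModule {
  theta :> functor (prodC A (powC n)) A;
  theta_unit : fix2 theta ([set: 'I_n] : powC n) = idF A;
  theta_cap : theta \of prodF theta (idF (powC n)) =
    theta \of prodF (idF A) (capF n) \of assocF A (powC n) (powC n) }.

Record comonad (A : category) : Type := Comonad {
  cm_functor :> functor A A;
  cm_delta : nattrans cm_functor (cm_functor \of cm_functor);
  cm_eps : nattrans cm_functor (idF A);
  cm_coassoc : forall a,
    fmap cm_functor (cm_delta a) \c cm_delta a =
    cm_delta (cm_functor a) \c cm_delta a;
  cm_counitl : forall a, cm_eps (cm_functor a) \c cm_delta a = idm _;
  cm_counitr : forall a,
    fmap cm_functor (cm_eps a) \c cm_delta a = idm (cm_functor a) }.

Definition strict_idempotent (A : category) (K : comonad A) : Prop :=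
  is_identity (cm_delta K).

Record comonad_family (A : category) (n : nat) : Type := ComonadFamily {
  cf_comonad :> 'I_n -> comonad A;
  cf_strict : forall i, strict_idempotent (cf_comonad i);
  cf_comm : forall i k : 'I_n,
    cf_comonad i \of cf_comonad k = cf_comonad k \of cf_comonad i }.

Record adjunction (C D : category) (L : functor C D) (R : functor D C) : Type :=
  Adjunction {
    adj_unit : nattrans (idF C) (R \of L);
    adj_counit : nattrans (L \of R) (idF D);
    adj_triangleL : forall c, adj_counit (L c) \c fmap L (adj_unit c) = idm (L c);
    adj_triangleR : forall d,
      fmap R (adj_counit d) \c adj_unit (R d) = idm (R d) }.

Section AdjunctionComonad.
Variables (C D : category) (L : functor C D) (R : functor D C).
Variable adj : adjunction L R.

Let K : functor D D := L \of R.

Lemma adj_delta_natural a b (f : hom a b) :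
  fmap L (adj_unit adj (R b)) \c fmap K f =
  fmap (K \of K) f \c fmap L (adj_unit adj (R a)).
Proof. by rewrite /= -!fmap_cmp (nt_natural (adj_unit adj)). Qed.

Let delta : nattrans K (K \of K) :=
  @NatTrans D D K (K \of K)
    (fun a => fmap L (adj_unit adj (R a))) adj_delta_natural.

Lemma adj_coassoc a : fmap K (delta a) \c delta a = delta (K a) \c delta a.
Proof. by rewrite /= -!fmap_cmp -(nt_natural (adj_unit adj)). Qed.

Lemma adj_counitl a : adj_counit adj (K a) \c delta a = idm (K a).
Proof. exact: (adj_triangleL adj (R a)). Qed.

Lemma adj_counitr a : fmap K (adj_counit adj a) \c delta a = idm (K a).
Proof. by rewrite /= -!fmap_cmp adj_triangleR fmap_id. Qed.

(* The comonad (L R, L eta R, eps) of an adjunction (eta, eps) : L -| R. *)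
Definition adj_comonad : comonad D :=
  @Comonad D K delta (adj_counit adj)
    adj_coassoc adj_counitl adj_counitr.
End AdjunctionComonad.

Section FullSubcategory.
Variables (A : category) (P : A -> Prop).

Definition fullC : category :=
  @Category {a : A | P a} (fun a b => hom (sval a) (sval b))
    (fun a => idm (sval a)) (fun _ _ _ g f => g \c f)
    (fun _ _ _ => cmp_idl _) (fun _ _ _ => cmp_idr _)
    (fun _ _ _ _ _ _ _ => cmpA _ _ _).

Definition inclF : functor fullC A :=
  @Functor fullC A sval (fun _ _ f => f)
    (fun _ => erefl) (fun _ _ _ _ _ => erefl).
End FullSubcategory.

Record coreflective (A : category) : Type := Coreflective {
  cr_sub : A -> Prop;
  cr_functor : functor A (fullC cr_sub);
  cr_adj : adjunction (inclF cr_sub) cr_functor }.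

Definition strict_coreflective (A : category) (S : coreflective A) : Prop :=
  is_identity (adj_unit (cr_adj S)).

(* [cr_restrict S T] is the restriction of the coreflection of S to T. *)
Definition cr_restrict (A : category) (S T : coreflective A) :
    functor (fullC (cr_sub T)) (fullC (cr_sub S)) :=
  cr_functor S \of inclF (cr_sub T).

Record coreflective_family (A : category) (n : nat) : Type :=
  CoreflectiveFamily {
    rf_sub :> 'I_n -> coreflective A;
    rf_strict : forall i, strict_coreflective (rf_sub i);
    rf_comm : forall i k : 'I_n,
      inclF (cr_sub (rf_sub i)) \of
        (cr_restrict (rf_sub i) (rf_sub k) \of cr_functor (rf_sub k)) =
      inclF (cr_sub (rf_sub k)) \of
        (cr_restrict (rf_sub k) (rf_sub i) \of cr_functor (rf_sub i)) }.

(* K_i = theta(-, n \ {i}), with counit theta(-, n \ {i}) -> theta(-, n) = Id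
   induced by the inclusion of n \ {i} in n; the comultiplication is then
   forced to be the identity. *)
Definition module_comonads (A : category) (n : nat)
    (M : pow_module A n) (K : comonad_family A n) : Prop :=
  forall i : 'I_n,
    cm_functor (K i) = fix2 M ([set~ i] : powC n) /\
    forall a : A,
      arr (cm_eps (K i) a) =
      arr (@fmap _ _ M (a, [set~ i]) (a, [set: 'I_n]) (idm a, subsetT [set~ i])).

Definition coreflective_comonads (A : category) (n : nat)
    (S : coreflective_family A n) (K : comonad_family A n) : Prop :=
  forall i : 'I_n, K i = adj_comonad (cr_adj (S i)).

(* Main.v *)
(* Endofunctors K of A with a transformation eps : K -> Id form a strict monoid.
   A strict idempotent comonad is such a pair with eps K = id = K eps, and if
   two of them commute as functors then they commute in this monoid.  Hence a
   commuting family (K_i) yields a homomorphism from subsets of {1, ..., n}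
   under intersection to this monoid, U |-> K_U = prod_{i notin U} K_i.
   Conversely, for a module theta the pair (theta(-, U), theta(-, U) -> Id) is
   the product of those of the sets n \ {i}, i notin U, and theta is determined
   by these pairs.
   A strict coreflective subcategory is recovered from its comonad K as the full
   subcategory of the a with K a = a. *)
Require Import Defs.
From HB Require Import structures.
From mathcomp Require Import all_boot.
From Stdlib Require Import FunctionalExtensionality PropExtensionality.
From Stdlib Require Import ProofIrrelevance.

Set Implicit Arguments.
Unset Strict Implicit.
Unset Printing Implicit Defensive.

Local Open Scope cat_scope.

(** * Comparing morphisms across equal endpoints *)

Section Arrows.
Variable C : category.
Implicit Types a b c : C.

(** Eliminating an equality of packed morphisms replaces both endpoints and the morphism at once, so
    no cast appears. *)
Lemma arr_ind a b (f : hom a b) (P : forall x y : C, hom x y -> Prop) :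
  P a b f -> forall x y (g : hom x y), arr f = arr g -> P x y g.
Proof.
move=> Pf x y g fg.
by have: (fun z : arrow C => P _ _ (projT2 z)) (arr g) by rewrite -fg.
Qed.

Lemma arr_dom a b x y (f : hom a b) (g : hom x y) : arr f = arr g -> a = x.
Proof. by move=> e; elim/arr_ind: e. Qed.

Lemma arr_cod a b x y (f : hom a b) (g : hom x y) : arr f = arr g -> b = y.
Proof. by move=> e; elim/arr_ind: e. Qed.

(** Proof irrelevance makes transport along a loop of endpoints trivial. *)
Lemma arr_inj a b : injective (@arr C a b).
Proof. by move=> f g; apply: inj_pair2. Qed.

Lemma arr_idm a b : a = b -> arr (idm a) = arr (idm b).
Proof. by move->. Qed.

Lemma arr_cmp a b c x y z (f : hom a b) (g : hom b c) (f' : hom x y)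
    (g' : hom y z) :
  arr f = arr f' -> arr g = arr g' -> arr (g \c f) = arr (g' \c f').
Proof.
move=> ef; elim/arr_ind: x y f' / ef g' => g' eg.
have ec := arr_cod eg; case: z / ec g' eg => g' eg.
by rewrite (arr_inj eg).
Qed.

(** A left unit law for [g] between equal but not convertible objects; with [arr_idr] it cancels
    strict identities throughout. *)
Lemma arr_idl a b c x (f : hom a b) (g : hom b c) :
  arr g = arr (idm x) -> arr (g \c f) = arr f.
Proof.
move=> eg; have eb := arr_dom eg; case: x / eb eg => eg.
have ec := arr_cod eg; case: b / ec f g eg => f g /arr_inj->.
by rewrite cmp_idl.
Qed.

Lemma arr_idr a b c x (f : hom a b) (g : hom b c) :
  arr f = arr (idm x) -> arr (g \c f) = arr g.
Proof.
move=> ef; have eb := arr_cod ef; case: x / eb ef => ef.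
have ea := arr_dom ef; case: b / ea f g ef => f g /arr_inj->.
by rewrite cmp_idr.
Qed.

Definition cast_dom a b c (e : a = b) (f : hom a c) : hom b c :=
  let: erefl := e in f.

Definition cast_cod a b c (e : b = c) (f : hom a b) : hom a c :=
  let: erefl := e in f.

Lemma arr_cast_dom a b c (e : a = b) (f : hom a c) :
  arr (cast_dom e f) = arr f.
Proof. by case: b / e. Qed.

Lemma arr_cast_cod a b c (e : b = c) (f : hom a b) :
  arr (cast_cod e f) = arr f.
Proof. by case: c / e. Qed.

End Arrows.

(** * Extensionality for functors and natural transformations *)

Section FunctorArrows.
Variables C D : category.
Implicit Types F G : functor C D.

Lemma arr_fmap F a b x y (f : hom a b) (g : hom x y) :
  arr f = arr g -> arr (fmap F f) = arr (fmap F g).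
Proof. by move=> e; elim/arr_ind: e. Qed.

Lemma arr_fmap_id F a b x (f : hom a b) :
  arr f = arr (idm x) -> arr (fmap F f) = arr (idm (F x)).
Proof. by move=> /(arr_fmap F) ->; rewrite fmap_id. Qed.

Lemma arr_ntc F G (t : nattrans F G) a b : a = b -> arr (t a) = arr (t b).
Proof. by move->. Qed.

Lemma functor_eq_arr F G a b (f : hom a b) :
  F = G -> arr (fmap F f) = arr (fmap G f).
Proof. by move->. Qed.

(** Equality on objects is read off from the packed identities. *)
Lemma functor_ext F G :
  (forall a b (f : hom a b), arr (fmap F f) = arr (fmap G f)) -> F = G.
Proof.
case: F G => [F Fm Fi Fc] [G Gm Gi Gc] /= FG.
have eFG : F = G.
  by apply: functional_extensionality => a; apply: arr_dom (FG _ _ (idm a)).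
case: G / eFG Gm Gi Gc FG => Gm Gi Gc FG.
have eFG : Fm = Gm.
  do 3![apply: functional_extensionality_dep => ?].
  by apply: arr_inj; apply: FG.
case: Gm / eFG Gi Gc FG => Gi Gc _.
by rewrite (proof_irrelevance _ Fi Gi) (proof_irrelevance _ Fc Gc).
Qed.

Lemma nattrans_ext F G (s t : nattrans F G) :
  (forall a, arr (s a) = arr (t a)) -> s = t.
Proof.
case: s t => [s sn] [t tn] /= st.
have e : s = t.
  by apply: functional_extensionality_dep => a; apply: arr_inj.
by case: t / e tn st => tn _; rewrite (proof_irrelevance _ sn tn).
Qed.

(** Naturality with identity components forces [F] and [G] to agree on morphisms, so strictness can
    be tested one object at a time. *)
Lemma is_identityP F G (t : nattrans F G) :
  is_identity t <-> forall a, arr (t a) = arr (idm (F a)).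
Proof.
split=> [[e ->] a|tid]; first by case: G / e t.
have e : F = G.
  apply: functor_ext => a b f.
  rewrite -(arr_idl (fmap F f) (tid b)) nt_natural.
  exact: arr_idr (tid a).
by exists e; apply: nattrans_ext => a; rewrite tid; case: G / e t tid.
Qed.

End FunctorArrows.

(** * The monoid of copointed endofunctors *)

Section Copointed.
Variable A : category.

(** A comonad stripped of its comultiplication, which strictness determines. *)
Record copointed : Type := Copointed {
  cp_functor :> functor A A;
  cp_eps : nattrans cp_functor (idF A) }.

Implicit Types K L : copointed.

Lemma copointed_ext K L :
  (forall a b (f : hom a b), arr (fmap K f) = arr (fmap L f)) ->
  (forall a, arr (cp_eps K a) = arr (cp_eps L a)) -> K = L.
Proof.
case: K L => [K k] [L l] /= /functor_ext e; case: L / e l => l kl.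
by rewrite (@nattrans_ext A A K (idF A) k l kl).
Qed.

Definition cp_one : copointed := Copointed (idN (idF A)).

Section Mul.
Variables K L : copointed.

Lemma cp_mul_natural a b (f : hom a b) :
  (cp_eps L b \c cp_eps K (L b)) \c fmap (K \of L) f =
  fmap (idF A) f \c (cp_eps L a \c cp_eps K (L a)).
Proof.
rewrite /= -cmpA (nt_natural (cp_eps K)) /= !cmpA.
by rewrite (nt_natural (cp_eps L)).
Qed.

(** The counit is the horizontal composite of the two counits; by naturality it is also
    [cp_eps K a \c fmap K (cp_eps L a)]. *)
Definition cp_mul : copointed :=
  @Copointed (K \of L)
    (@NatTrans A A (K \of L) (idF A)
       (fun a => cp_eps L a \c cp_eps K (L a)) cp_mul_natural).
End Mul.

Lemma cp_mulA : associative cp_mul.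
Proof. by move=> K L M; apply: copointed_ext => //= a; rewrite cmpA. Qed.

Lemma cp_mul1 : left_id cp_one cp_mul.
Proof. by move=> K; apply: copointed_ext => //= a; rewrite cmp_idr. Qed.

Lemma cp_mulr1 : right_id cp_one cp_mul.
Proof. by move=> K; apply: copointed_ext => //= a; rewrite cmp_idl. Qed.

HB.instance Definition _ :=
  Monoid.isLaw.Build copointed cp_one cp_mul cp_mulA cp_mul1 cp_mulr1.

(* This is stronger than [cp_mul K K = K], which only yields
   [eps a \c eps (K a) = eps a]. *)
Definition cp_idem K : Prop :=
  (forall a, arr (cp_eps K (K a)) = arr (idm (K a))) /\
  (forall a, arr (fmap K (cp_eps K a)) = arr (idm (K a))).

Lemma cp_idem_ob K : cp_idem K -> forall a, K (K a) = K a.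
Proof. by case=> epsK _ a; apply: arr_dom (epsK a). Qed.

(** Naturality of the counit at [fmap K f], where both components are identities. *)
Lemma cp_idem_fmap K : cp_idem K ->
  forall a b (f : hom a b), arr (fmap K (fmap K f)) = arr (fmap K f).
Proof.
case=> epsK _ a b f; rewrite -(arr_idl (fmap K (fmap K f)) (epsK b)).
by rewrite (nt_natural (cp_eps K)); apply: arr_idr (epsK a).
Qed.

Lemma cp_idem_one : cp_idem cp_one.
Proof. by []. Qed.

Lemma cp_idem_mulK K : cp_idem K -> cp_mul K K = K.
Proof.
move=> iK; apply: copointed_ext => [a b f|a] /=; first exact: cp_idem_fmap.
exact: arr_idr (iK.1 a).
Qed.

(* [K eps_L] and [eps_L K] both become identities under [L], and [L] is
   faithful on maps from [L]-coreflective objects. *)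
Lemma cp_idem_eps_comm K L : cp_idem L -> K \of L = L \of K ->
  forall a, arr (fmap K (cp_eps L a)) = arr (cp_eps L (K a)).
Proof.
move=> iL KL a; have KLf b c (f : hom b c) := functor_eq_arr f KL.
have KLo b : K (L b) = L (K b) by apply: arr_dom (KLf _ _ (idm b)).
have eKL : arr (cp_eps L (K (L a))) = arr (idm (L (K a))).
  by rewrite (arr_ntc _ (KLo a)); apply: iL.1.
(* After precomposing with the identity [cp_eps L (K (L a))], naturality of [cp_eps L] brings
   [cp_eps L (K a)] to the front; what remains is [L K] applied to [cp_eps L a], hence [K L] applied
   to it, an identity. *)
rewrite -(arr_idr (fmap K (cp_eps L a)) eKL).
rewrite -[fmap K _ \c _]/(fmap (idF A) _ \c _) -(nt_natural (cp_eps L)).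
apply: (@arr_idr _ _ _ _ (K (L a))).
rewrite -[LHS](KLf _ _ (cp_eps L a)) /=.
by apply: arr_fmap_id; apply: iL.2.
Qed.

(** The counits are [cp_eps K a] after [fmap K (cp_eps L a)] and [cp_eps K a] after
    [cp_eps L (K a)]; [cp_idem_eps_comm] equates the inner factors. *)
Lemma cp_idem_mulC K L : cp_idem L -> K \of L = L \of K ->
  cp_mul K L = cp_mul L K.
Proof.
move=> iL KL; apply: copointed_ext => [a b f|a] /=.
  exact: (functor_eq_arr f KL).
rewrite -[cp_eps L a \c _]/(fmap (idF A) _ \c _) -(nt_natural (cp_eps K)).
by apply: arr_cmp => //; apply: cp_idem_eps_comm.
Qed.

Lemma cp_mul_of K L : cp_mul K L = cp_mul L K -> K \of L = L \of K.
Proof. exact: (congr1 cp_functor). Qed.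

(** Since [K (L a) = L (K a)] is fixed by both functors, each of the two factors of the counit
    becomes an identity. *)
Lemma cp_idem_mul K L : cp_idem K -> cp_idem L -> cp_mul K L = cp_mul L K ->
  cp_idem (cp_mul K L).
Proof.
move=> iK iL /cp_mul_of KL.
have KLo b : K (L b) = L (K b) by apply: arr_dom (functor_eq_arr (idm b) KL).
split=> a /=.
  have LKL : L (K (L a)) = K (L a) by rewrite KLo cp_idem_ob.
  rewrite (arr_idl (x := K (L a))).
    by rewrite (arr_ntc (cp_eps K) LKL); apply: iK.1.
  by rewrite (arr_ntc (cp_eps L) (KLo a)) KLo; apply: iL.1.
rewrite !fmap_cmp (arr_idl (x := K (L a))).
  rewrite -[LHS]/(arr (fmap (K \of L) _)) KL /=.
  rewrite (arr_fmap_id L (iK.2 (L a))).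
  by apply: arr_idm; rewrite -KLo cp_idem_ob.
by apply: arr_fmap_id; apply: iL.2.
Qed.

(** * Strict idempotent comonads as idempotent copointed endofunctors *)

Section Comonad.
Variables (K : copointed) (iK : cp_idem K).

Let eK a : K a = K (K a) := esym (cp_idem_ob iK a).
Let dl a : hom (K a) (K (K a)) := cast_cod (eK a) (idm (K a)).
Let arr_dl a : arr (dl a) = arr (idm (K a)).
Proof. exact: arr_cast_cod. Qed.

Lemma cp_delta_natural a b (f : hom a b) :
  dl b \c fmap K f = fmap (K \of K) f \c dl a.
Proof.
apply: arr_inj; rewrite (arr_idl _ (arr_dl b)) (arr_idr _ (arr_dl a)).
by rewrite /= cp_idem_fmap.
Qed.

Let delta := @NatTrans A A K (K \of K) dl cp_delta_natural.

Lemma cp_coassoc a :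
  fmap K (delta a) \c delta a = delta (K a) \c delta a.
Proof.
apply: arr_inj; rewrite (arr_idl _ (arr_fmap_id K (arr_dl a))).
by rewrite (arr_idl _ (arr_dl (K a))).
Qed.

Lemma cp_counitl a : cp_eps K (K a) \c delta a = idm _.
Proof. by apply: arr_inj; rewrite (arr_idl _ (iK.1 a)); apply: arr_dl. Qed.

Lemma cp_counitr a : fmap K (cp_eps K a) \c delta a = idm (K a).
Proof. by apply: arr_inj; rewrite (arr_idl _ (iK.2 a)); apply: arr_dl. Qed.

Definition cp_comonad : comonad A :=
  @Comonad A K delta (cp_eps K) cp_coassoc cp_counitl cp_counitr.

Lemma cp_comonad_strict : strict_idempotent cp_comonad.
Proof. exact/is_identityP. Qed.
End Comonad.

Definition comonad_cp (K : comonad A) : copointed := Copointed (cm_eps K).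

(** Once the comultiplication is an identity, the two counit laws are the two clauses of
    [cp_idem]. *)
Lemma comonad_cp_idem (K : comonad A) :
  strict_idempotent K -> cp_idem (comonad_cp K).
Proof.
move=> /is_identityP dK; split=> a /=.
  by rewrite -(cm_counitl K a) (arr_idr _ (dK a)).
by rewrite -(cm_counitr K a) (arr_idr _ (dK a)).
Qed.

(** Both comultiplications have packed identities as components, and the laws agree by proof
    irrelevance. *)
Lemma strict_comonad_ext (K L : comonad A) :
  strict_idempotent K -> strict_idempotent L ->
  comonad_cp K = comonad_cp L -> K = L.
Proof.
case: K L => [K kd ke ka kl kr] [L ld le la ll lr].
move=> /is_identityP /= sK /is_identityP /= sL [].
move=> e; case: L / e ld le la ll lr sL => ld le la ll lr sL E.
have e := inj_pair2 _ _ _ _ _ E.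
case: le / e ll lr {E} => ll lr.
have e : kd = ld by apply: nattrans_ext => a; rewrite sK.
case: ld / e la ll lr {sL} => la ll lr.
rewrite (proof_irrelevance _ ka la) (proof_irrelevance _ kl ll).
by rewrite (proof_irrelevance _ kr lr).
Qed.

End Copointed.

Arguments cp_one {A}.

Lemma comonad_family_ext (A : category) n (K L : comonad_family A n) :
  (forall i, comonad_cp (K i) = comonad_cp (L i)) -> K = L.
Proof.
case: K L => [K sK cK] [L sL cL] /= KL.
have e : K = L.
  by apply: functional_extensionality => i; apply: strict_comonad_ext.
case: L / e sL cL {KL} => sL cL.
by rewrite (proof_irrelevance _ sK sL) (proof_irrelevance _ cK cL).
Qed.

(** * Products of commuting idempotents *)

Section BigIdempotent.
Variables (T : Type) (idx : T) (op : Monoid.law idx) (I : Type) (F : I -> T).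
Hypotheses (Fidem : forall i, op (F i) (F i) = F i)
  (FC : forall i j, op (F i) (F j) = op (F j) (F i)).

Let opA : associative op.
Proof. exact: Monoid.mulmA. Qed.

Lemma big_commute (r : seq I) (P : pred I) i :
  op (F i) (\big[op/idx]_(j <- r | P j) F j) =
  op (\big[op/idx]_(j <- r | P j) F j) (F i).
Proof.
elim/big_rec: _ => [|j x _ IHx]; first by rewrite Monoid.mul1m Monoid.mulm1.
by rewrite opA FC -!opA IHx.
Qed.

(** A factor occurring in both products is moved past the first by [big_commute] and absorbed by
    [Fidem]; only the [F i] are assumed to commute, not the whole monoid. *)
Lemma big_idem_predU (r : seq I) (P Q : pred I) :
  op (\big[op/idx]_(i <- r | P i) F i) (\big[op/idx]_(i <- r | Q i) F i) =
  \big[op/idx]_(i <- r | P i || Q i) F i.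
Proof.
elim: r => [|i r IHr]; first by rewrite !big_nil Monoid.mul1m.
rewrite !big_cons; case: (P i); case: (Q i) => //=; rewrite -IHr.
- by rewrite -opA [X in op _ X]opA -big_commute -!opA opA Fidem.
- by rewrite -opA.
- by rewrite !opA big_commute.
Qed.

End BigIdempotent.

(** * From copointed endofunctors to a module *)

Lemma pow_module_ext (A : category) n (M N : pow_module A n) :
  theta M = theta N -> M = N.
Proof.
case: M N => [M Mu Mc] [N Nu Nc] /= e; case: N / e Nu Nc => Nu Nc.
by rewrite (proof_irrelevance _ Mu Nu) (proof_irrelevance _ Mc Nc).
Qed.

(* On a morphism [U <= V], [theta(a, -)] has to be [eps_U] at [K_V a], whose
   source [K_U (K_V a)] is equal, but not convertible, to [K_U a]. *)
Section ModuleOfCopointed.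
Variables (A : category) (n : nat) (k : {set 'I_n} -> copointed A).
Hypotheses (k1 : k [set: 'I_n] = cp_one)
  (kM : forall U V, cp_mul (k U) (k V) = k (U :&: V))
  (kI : forall U, cp_idem (k U)).
Implicit Types U V W : {set 'I_n}.

Let kC U V : k U \of k V = k V \of k U.
Proof. by apply: cp_mul_of; rewrite !kM setIC. Qed.

Let kMf U V a b (f : hom a b) :
  arr (fmap (k (U :&: V)) f) = arr (fmap (k U) (fmap (k V) f)).
Proof. by rewrite -kM. Qed.

Let kMe U V a :
  arr (cp_eps (k (U :&: V)) a) =
  arr (cp_eps (k V) a \c cp_eps (k U) (k V a)).
Proof. by rewrite -kM. Qed.

Let kMo U V a : k (U :&: V) a = k U (k V a).
Proof. by rewrite -kM. Qed.

Let kSo U V a : U \subset V -> k U (k V a) = k U a.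
Proof. by move=> /setIidPl sUV; rewrite -kMo sUV. Qed.

Definition cp_res U V (s : U \subset V) a : hom (k U a) (k V a) :=
  cast_dom (kSo a s) (cp_eps (k U) (k V a)).

Lemma arr_cp_res U V (s : U \subset V) a :
  arr (cp_res s a) = arr (cp_eps (k U) (k V a)).
Proof. exact: arr_cast_dom. Qed.

(** Naturality of the counit of [k U] at [fmap (k V) f], because [k U] and [k V] compose to
    [k U]. *)
Lemma cp_res_natural U V (s : U \subset V) a b (f : hom a b) :
  cp_res s b \c fmap (k U) f = fmap (k V) f \c cp_res s a.
Proof.
apply: arr_inj.
transitivity (arr (cp_eps (k U) (k V b) \c fmap (k U) (fmap (k V) f))).
  apply: arr_cmp; last exact: arr_cp_res.
  by rewrite -kMf (setIidPl s).
rewrite nt_natural; apply: arr_cmp => //.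
by rewrite arr_cp_res.
Qed.

Lemma cp_res_id U (s : U \subset U) a : cp_res s a = idm (k U a).
Proof. by apply: arr_inj; rewrite arr_cp_res; apply: (kI U).1. Qed.

(** Writing [U] as [U :&: V] splits its counit at [k W a] into that of [V] there, after that of [U]
    at [k V (k W a) = k V a]. *)
Lemma cp_res_cmp U V W (s : U \subset V) (t : V \subset W)
    (u : U \subset W) a :
  cp_res t a \c cp_res s a = cp_res u a.
Proof.
apply: arr_inj; rewrite arr_cp_res.
rewrite -[in RHS](setIidPl s) kMe; apply: arr_cmp; last exact: arr_cp_res.
by rewrite arr_cp_res; apply: arr_ntc; rewrite kSo.
Qed.

Let tob (x : prodC A (powC n)) : A := k x.2 x.1.
Let tmap (x y : prodC A (powC n)) (f : hom x y) : hom (tob x) (tob y) :=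
  cp_res f.2 y.1 \c fmap (k x.2) f.1.

Lemma cp_theta_id x : tmap (idm x) = idm (tob x).
Proof. by rewrite /tmap /= fmap_id cmp_idr cp_res_id. Qed.

Lemma cp_theta_cmp x y z (g : hom y z) (f : hom x y) :
  tmap (g \c f) = tmap g \c tmap f.
Proof.
rewrite /tmap /= fmap_cmp -(cp_res_cmp f.2 g.2).
rewrite -!cmpA; congr (_ \c _); rewrite !cmpA; congr (_ \c _).
exact: cp_res_natural.
Qed.

Definition cp_theta : functor (prodC A (powC n)) A :=
  Functor cp_theta_id cp_theta_cmp.

Lemma fix2_cp_theta U : fix2 cp_theta (U : powC n) = k U.
Proof.
apply: functor_ext => a b f /=.
by rewrite /tmap /= cp_res_id cmp_idl.
Qed.

Lemma cp_theta_unit : fix2 cp_theta ([set: 'I_n] : powC n) = idF A.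
Proof. by rewrite fix2_cp_theta k1. Qed.

Lemma cp_theta_cap : cp_theta \of prodF cp_theta (idF (powC n)) =
  cp_theta \of prodF (idF A) (capF n) \of assocF A (powC n) (powC n).
Proof.
apply: functor_ext => -[[a U] V] [[b U'] V'] [[f s] t] /=.
rewrite /tmap; rewrite /= in f s t *.
rewrite fmap_cmp cmpA; apply: arr_cmp; first by rewrite -kMf setIC.
rewrite -/(tob (b, U')) /tob /= cp_res_natural arr_cp_res setIC.
(* The counit of the intersection splits into that of [V] followed by that of [U];
   [cp_idem_eps_comm] identifies the latter with [k V'] applied to the restriction along [s]. *)
transitivity (arr (cp_eps (k U) (k V' (k U' b))
                     \c cp_eps (k V) (k U (k V' (k U' b))))).
  apply: arr_cmp.
    rewrite arr_cp_res; apply: arr_ntc.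
    by rewrite -!kMo setIAC (setIidPl s) setIC.
  rewrite (arr_fmap _ (arr_cp_res s b)).
  by apply: cp_idem_eps_comm.
rewrite -kMe; apply: arr_ntc.
by rewrite -kMo setIC.
Qed.

Definition cp_module : pow_module A n := PowModule cp_theta_unit cp_theta_cap.

(** The same formula as [arr_theta_module_cp] gives for an arbitrary module, so that modules can be
    compared through their copointed endofunctors. *)
Lemma arr_cp_module U V (s : U \subset V) a b (f : hom a b) :
  arr (@fmap _ _ cp_module (a, U) (b, V) (f, s)) =
  arr (cp_eps (k U) (k V b) \c fmap (k U) (fmap (k V) f)).
Proof.
rewrite /= /tmap /=; apply: arr_cmp; last exact: arr_cp_res.
by rewrite -kMf (setIidPl s).
Qed.

End ModuleOfCopointed.

(** * From a module to copointed endofunctors *)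

Section CopointedOfModule.
Variables (A : category) (n : nat) (M : pow_module A n).
Implicit Types U V W : {set 'I_n}.

Let th U V a b (f : hom a b) (s : U \subset V) : hom (M (a, U)) (M (b, V)) :=
  @fmap _ _ M (a, U) (b, V) (f, s).

Let arr_th U V U' V' a b a' b' (f : hom a b) (f' : hom a' b')
    (s : U \subset V) (s' : U' \subset V') :
  arr f = arr f' -> U = U' -> V = V' -> arr (th f s) = arr (th f' s').
Proof.
move=> e eU eV; elim/arr_ind: a' b' f' / e.
case: U' / eU s' => s'; case: V' / eV s' => s'.
by rewrite (bool_irrelevance s s').
Qed.

Let th_id U a (s : U \subset U) : th (idm a) s = idm (M (a, U)).
Proof.
by rewrite -(fmap_id M (a, U)); apply: arr_inj; apply: arr_th.
Qed.

Let th_cmp U V W a b c (g : hom b c) (f : hom a b) (t : V \subset W)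
    (s : U \subset V) (u : U \subset W) : th (g \c f) u = th g t \c th f s.
Proof.
apply: arr_inj; rewrite /th -(fmap_cmp M) /=.
exact: arr_th.
Qed.

Let th_unit a b (f : hom a b) (s : [set: 'I_n] \subset [set: 'I_n]) :
  arr (th f s) = arr f.
Proof. by rewrite -(functor_eq_arr f (theta_unit M)); apply: arr_th. Qed.

Let th_cap U V U' V' a b (f : hom a b) (s : U \subset V) (s' : U' \subset V')
    (t : U :&: U' \subset V :&: V') :
  arr (th (th f s) s') = arr (th f t).
Proof.
have := functor_eq_arr (C := prodC (prodC A (powC n)) (powC n))
          (a := (a, U, U')) (b := (b, V, V')) ((f, s), s') (theta_cap M).
by rewrite /= => ->; apply: arr_th.
Qed.

Let oT a : M (a, [set: 'I_n]) = a.
Proof. exact: arr_dom (th_unit (idm a) (subxx _)). Qed.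

Let ev U a : hom (M (a, U)) a := cast_cod (oT a) (th (idm a) (subsetT U)).
Let arr_ev U a : arr (ev U a) = arr (th (idm a) (subsetT U)).
Proof. exact: arr_cast_cod. Qed.

(** Both sides are the action of the pair of [f] and [subsetT U], factored in the two possible
    orders. *)
Lemma module_eps_natural U a b (f : hom a b) :
  ev U b \c fmap (fix2 M (U : powC n)) f = fmap (idF A) f \c ev U a.
Proof.
apply: arr_inj.
transitivity (arr (th f (subsetT U))).
  rewrite -{2}(cmp_idl f) (th_cmp _ _ (subsetT U) (subxx U)).
  by apply: arr_cmp (arr_ev _ _); apply: arr_th.
rewrite -{1}(cmp_idr f) (th_cmp _ _ (subxx _) (subsetT U)).
by apply: arr_cmp; [rewrite arr_ev | rewrite th_unit].
Qed.

Definition module_cp U : copointed A :=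
  @Copointed A (fix2 M (U : powC n))
    (@NatTrans A A (fix2 M (U : powC n)) (idF A) (ev U)
       (@module_eps_natural U)).

Lemma arr_module_eps U a :
  arr (cp_eps (module_cp U) a) =
  arr (@fmap _ _ M (a, U) (a, [set: 'I_n]) (idm a, subsetT U)).
Proof. exact: arr_ev. Qed.

(** Writing the identity of [M (a, V)] as the image of an identity makes this an instance of
    [theta_cap]. *)
Lemma arr_module_eps_theta U V a (s : U :&: V \subset V) :
  arr (cp_eps (module_cp U) (M (a, V))) =
  arr (@fmap _ _ M (a, U :&: V) (a, V) (idm a, s)).
Proof.
rewrite arr_module_eps -/(th _ _) -(th_id a (subxx V)).
have t : V :&: U \subset V :&: setT by rewrite setIT subsetIl.
by rewrite (th_cap _ _ _ t); apply: arr_th; rewrite ?setIT // setIC.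
Qed.

Lemma module_cp1 : module_cp [set: 'I_n] = cp_one.
Proof.
apply: copointed_ext => [a b f|a]; first exact: th_unit.
by rewrite arr_module_eps; apply: th_unit.
Qed.

Lemma module_cpM U V :
  cp_mul (module_cp U) (module_cp V) = module_cp (U :&: V).
Proof.
apply: copointed_ext => [a b f|a].
  have t : V :&: U \subset V :&: U by [].
  rewrite [LHS](th_cap f (subxx V) (subxx U) t).
  by apply: arr_th; rewrite // setIC.
rewrite arr_module_eps -/(th _ _) -(cmp_idl (idm a)).
have s : U :&: V \subset V by apply: subsetIr.
rewrite (th_cmp _ _ (subsetT V) s).
apply: arr_cmp; last exact: arr_module_eps.
exact: arr_module_eps_theta.
Qed.

(** By [theta_cap] both whiskered counits come from inclusions of [U :&: U] in a set equal to
    [U]. *)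
Lemma module_cp_idem U : cp_idem (module_cp U).
Proof.
split=> a.
  have s : U :&: U \subset U by rewrite setIid.
  rewrite (arr_module_eps_theta _ s) -(th_id a (subxx U)).
  by apply: arr_th; rewrite // setIid.
rewrite -(th_id a (subxx U)).
have t : U :&: U \subset setT :&: U by rewrite setTI subsetIl.
transitivity (arr (th (th (idm a) (subsetT U)) (subxx U))).
  by apply: arr_th => //; apply: arr_module_eps.
by rewrite (th_cap _ _ _ t); apply: arr_th; rewrite ?setIid ?setTI.
Qed.

(** The pair [(f, s)] factors as [f] over the identity of [U], followed by the identity of [b] over
    [s]; [theta_cap] rewrites each factor. *)
Lemma arr_theta_module_cp U V (s : U \subset V) a b (f : hom a b) :
  arr (@fmap _ _ M (a, U) (b, V) (f, s)) =
  arr (cp_eps (module_cp U) (module_cp V b)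
         \c fmap (module_cp U) (fmap (module_cp V) f)).
Proof.
rewrite -/(th f s) -{1}(cmp_idl f) (th_cmp _ _ s (subxx U)).
apply: arr_cmp.
  have t : V :&: U \subset V :&: U by [].
  rewrite -[RHS]/(arr (th (th f _) _)) (th_cap _ _ _ t).
  by apply: arr_th; rewrite // (setIidPr s).
have t : U :&: V \subset V by apply: subsetIr.
rewrite -/(th _ _) (arr_module_eps_theta _ t); apply: arr_th => //.
by rewrite (setIidPl s).
Qed.

(** [U] is the intersection of the [[set~ i]] with [i] outside [U], and [module_cp] turns
    intersections into products. *)
Lemma module_cp_big U :
  module_cp U = \big[@cp_mul A/cp_one]_(i | i \notin U) module_cp [set~ i].
Proof.
rewrite -(big_morph module_cp (id1 := cp_one) (op1 := @cp_mul A)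
           (id2 := setT) (op2 := @setI _)) ?module_cp1 //.
  congr module_cp; apply/setP=> j; apply/idP/bigcapP => [jU i|jU].
    by rewrite !inE; apply: contraNneq => <-.
  by apply: contraT => /jU; rewrite !inE eqxx.
by move=> V W; rewrite module_cpM.
Qed.

Definition module_family : comonad_family A n.
Proof.
refine (@ComonadFamily A n (fun i => cp_comonad (module_cp_idem [set~ i]))
          (fun i => cp_comonad_strict _) _).
by move=> i j; apply: cp_mul_of; rewrite !module_cpM setIC.
Defined.

End CopointedOfModule.

(** * Modules and commuting families of comonads *)

Section ModuleOfFamily.
Variables (A : category) (n : nat) (K : comonad_family A n).
Implicit Types U V : {set 'I_n}.

Let c i := comonad_cp (K i).

Let cI i : cp_idem (c i).
Proof. exact: comonad_cp_idem (cf_strict K i). Qed.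

Let cC i j : cp_mul (c i) (c j) = cp_mul (c j) (c i).
Proof. by apply: cp_idem_mulC => //; apply: (cf_comm K). Qed.

Definition family_cp U : copointed A :=
  \big[@cp_mul A/cp_one]_(i | i \notin U) c i.

Lemma family_cp1 : family_cp [set: 'I_n] = cp_one.
Proof. by rewrite /family_cp big_pred0 // => i; rewrite inE. Qed.

Lemma family_cpM U V : cp_mul (family_cp U) (family_cp V) = family_cp (U :&: V).
Proof.
rewrite /family_cp big_idem_predU //=.
  by apply: eq_bigl => i; rewrite inE negb_and.
by move=> i; apply: cp_idem_mulK.
Qed.

Lemma family_cp_idem U : cp_idem (family_cp U).
Proof.
rewrite /family_cp; elim: (index_enum _) => [|i r IHr].
  by rewrite big_nil; apply: cp_idem_one.
rewrite big_cons; case: ifP => // _.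
by apply: cp_idem_mul => //; apply: big_commute.
Qed.

Lemma family_cp_setC1 i : family_cp [set~ i] = comonad_cp (K i).
Proof.
by rewrite /family_cp (big_pred1 i) // => j; rewrite !inE negbK.
Qed.

Definition family_module : pow_module A n :=
  cp_module family_cp1 family_cpM family_cp_idem.

End ModuleOfFamily.

(** Both modules are given by one formula in their copointed endofunctors, and these agree by
    [module_cp_big]. *)
Lemma module_familyK A n : cancel (@module_family A n) (@family_module A n).
Proof.
move=> M; apply: pow_module_ext; apply: functor_ext => -[a U] [b V] [f s].
rewrite arr_cp_module arr_theta_module_cp.
have kE W : family_cp (module_family M) W = module_cp M W.
  by rewrite module_cp_big.
by rewrite !kE.
Qed.

Lemma family_moduleK A n : cancel (@family_module A n) (@module_family A n).
Proof.
move=> K; apply: comonad_family_ext => i; rewrite -[RHS]family_cp_setC1.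
apply: copointed_ext => [a b f|a].
  by apply: functor_eq_arr; apply: fix2_cp_theta.
rewrite [LHS]arr_module_eps arr_cp_module !fmap_id cmp_idr.
by apply: arr_ntc; rewrite family_cp1.
Qed.

(** * Strict coreflective subcategories and their comonads *)

Lemma arr_full (A : category) (P : A -> Prop) (a b x y : fullC P)
    (f : hom a b) (g : hom x y) :
  arr (fmap (inclF P) f) = arr (fmap (inclF P) g) -> arr f = arr g.
Proof.
case: a b x y f g => [a Pa] [b Pb] [x Px] [y Py] /= f g fg.
elim/arr_ind: x y g / fg Px Py => Px Py.
by rewrite (proof_irrelevance _ Px Pa) (proof_irrelevance _ Py Pb).
Qed.

Section Coreflective.
Variable A : category.
Implicit Types S T : coreflective A.

Lemma adj_comonad_strict S :
  strict_coreflective S -> strict_idempotent (adj_comonad (cr_adj S)).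
Proof.
move=> /is_identityP sS; apply/is_identityP => a /=.
exact: (arr_fmap (inclF (cr_sub S)) (sS (cr_functor S a))).
Qed.

(** An identity unit has equal endpoints; conversely, values of the coreflection lie in the
    subcategory. *)
Lemma cr_subE S a : strict_coreflective S ->
  cr_sub S a <-> adj_comonad (cr_adj S) a = a.
Proof.
move=> /is_identityP sS; split=> [Sa|<-]; last exact: (svalP (cr_functor S a)).
exact: (congr1 (inclF (cr_sub S)) (arr_cod (sS (exist _ a Sa)))).
Qed.

(** [cr_subE] recovers the subcategory, [arr_full] the coreflection from its composite with the
    inclusion; the counit is that of the comonad, and the units are identities. *)
Lemma adj_comonad_inj S T :
  strict_coreflective S -> strict_coreflective T ->
  adj_comonad (cr_adj S) = adj_comonad (cr_adj T) -> S = T.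
Proof.
move=> sS sT ST.
have e : cr_sub S = cr_sub T.
  apply: functional_extensionality => a; apply: propositional_extensionality.
  by rewrite !cr_subE // ST.
have := congr1 (@comonad_cp A) ST.
case: S T e {ST} sS sT => [P R [u e tL tR]] [Q R' [u' e' tL' tR']] /= eP.
case: Q / eP R' u' e' tL' tR' => R' u' e' tL' tR'.
move=> /is_identityP sS /is_identityP sT RR'.
have RR'f a b (f : hom a b) :
    arr (fmap (inclF P \of R) f) = arr (fmap (inclF P \of R') f).
  exact: functor_eq_arr (congr1 (@cp_functor A) RR').
have eR : R = R'.
  by apply: functor_ext => a b f; apply: arr_full; apply: RR'f.
case: R' / eR u' e' tL' tR' sT RR' {RR'f} => u' e' tL' tR' /= sT [].
move=> E; have ee := inj_pair2 _ _ _ _ _ E.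
case: e' / ee tL' tR' {E} => tL' tR'.
have eu : u = u' by apply: nattrans_ext => a; rewrite sS.
case: u' / eu tL' tR' {sT} => tL' tR'.
by rewrite (proof_irrelevance _ tL tL') (proof_irrelevance _ tR tR').
Qed.

Section OfComonad.
Variables (K : comonad A) (sK : strict_idempotent K).

Let iK : cp_idem (comonad_cp K) := comonad_cp_idem sK.
Let P a := K a = a.
Let Ro a : fullC P := exist P (K a) (cp_idem_ob iK a).

Definition comonad_coreflection : functor A (fullC P) :=
  @Functor A (fullC P) Ro (fun _ _ f => fmap K f) (fmap_id K) (@fmap_cmp _ _ K).

Let arr_eps a : P a -> arr (cm_eps K a) = arr (idm a).
Proof. by move=> <-; apply: iK.1. Qed.

Let un (a : fullC P) : @hom (fullC P) a (Ro (sval a)) :=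
  cast_cod (esym (svalP a)) (idm (sval a)).

Let arr_un (a : fullC P) : @arr A _ _ (un a) = arr (idm (sval a)).
Proof. exact: arr_cast_cod. Qed.

Lemma comonad_unit_natural a b (f : @hom (fullC P) a b) :
  un b \c fmap (idF (fullC P)) f =
  fmap (comonad_coreflection \of inclF P) f \c un a.
Proof.
(* Morphisms of the full subcategory are morphisms of [A], so the equation is checked in [A]. *)
apply: (@arr_inj A) => /=.
rewrite (@arr_idl A _ _ _ _ _ (un b) (arr_un b)).
rewrite (@arr_idr A _ _ _ _ (un a) _ (arr_un a)).
rewrite -(arr_idl (fmap K f) (arr_eps (svalP b))).
by rewrite (nt_natural (cm_eps K)); rewrite (arr_idr _ (arr_eps (svalP a))).
Qed.

Lemma comonad_counit_natural a b (f : hom a b) :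
  cm_eps K b \c fmap (inclF P \of comonad_coreflection) f =
  fmap (idF A) f \c cm_eps K a.
Proof. exact: (nt_natural (cm_eps K) f). Qed.

Definition comonad_adjunction : adjunction (inclF P) comonad_coreflection.
Proof.
refine (@Adjunction (fullC P) A (inclF P) comonad_coreflection
         (@NatTrans _ _ (idF (fullC P)) (comonad_coreflection \of inclF P)
            un comonad_unit_natural)
         (@NatTrans _ _ (inclF P \of comonad_coreflection) (idF A)
            (cm_eps K) comonad_counit_natural) _ _).
- move=> a; apply: arr_inj => /=.
  rewrite (arr_idl _ (arr_eps (svalP a))).
  exact: arr_un.
- move=> a; apply: (@arr_inj A) => /=.
  by rewrite (arr_idl _ (iK.2 a)); apply: (arr_un (Ro a)).
Defined.

Definition comonad_coreflective : coreflective A :=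
  Coreflective comonad_adjunction.

Lemma comonad_coreflective_strict : strict_coreflective comonad_coreflective.
Proof.
by apply/is_identityP => a; apply: arr_full; apply: arr_un.
Qed.

Lemma comonad_coreflectiveK : adj_comonad (cr_adj comonad_coreflective) = K.
Proof.
apply: strict_comonad_ext => //.
  exact: adj_comonad_strict comonad_coreflective_strict.
exact: copointed_ext.
Qed.

End OfComonad.
End Coreflective.

(** * Families of coreflective subcategories *)

Section CoreflectiveFamily.
Variables (A : category) (n : nat).

Definition coreflective_comonad_family (S : coreflective_family A n) :
  comonad_family A n.
Proof.
refine (@ComonadFamily A n (fun i => adj_comonad (cr_adj (S i)))
          (fun i => adj_comonad_strict (rf_strict S i)) _).
(* The two commutation conditions differ only in bracketing, so on morphisms they agree by
   conversion. *)
move=> i j; apply: functor_ext => a b f.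
exact: (functor_eq_arr f (rf_comm S i j)).
Defined.

Definition comonad_coreflective_family (K : comonad_family A n) :
  coreflective_family A n.
Proof.
refine (@CoreflectiveFamily A n
          (fun i => comonad_coreflective (cf_strict K i))
          (fun i => comonad_coreflective_strict _) _).
move=> i j; apply: functor_ext => a b f.
exact: (functor_eq_arr f (cf_comm K i j)).
Defined.

Lemma coreflective_family_ext (S T : coreflective_family A n) :
  (forall i, S i = T i) -> S = T.
Proof.
case: S T => [S sS cS] [T sT cT] /= /functional_extensionality e.
case: T / e sT cT => sT cT.
by rewrite (proof_irrelevance _ sS sT) (proof_irrelevance _ cS cT).
Qed.

Lemma comonad_coreflective_familyK :
  cancel comonad_coreflective_family coreflective_comonad_family.
Proof.
move=> K; apply: comonad_family_ext => i.
by rewrite [coreflective_comonad_family _ i]comonad_coreflectiveK.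
Qed.

Lemma coreflective_comonad_familyK :
  cancel coreflective_comonad_family comonad_coreflective_family.
Proof.
move=> S; apply: coreflective_family_ext => i.
apply: adj_comonad_inj; [exact: rf_strict | exact: rf_strict |].
exact: comonad_coreflectiveK.
Qed.

End CoreflectiveFamily.

Theorem proposition3p4 (A : category) (n : nat) :
  exists (f : pow_module A n -> comonad_family A n)
         (g : coreflective_family A n -> comonad_family A n),
    [/\ bijective f,
        bijective g,
        forall M : pow_module A n, module_comonads M (f M) &
        forall S : coreflective_family A n, coreflective_comonads S (g S)].
Proof.
exists (@module_family A n), (@coreflective_comonad_family A n); split.
- by exists (@family_module A n);
    [apply: module_familyK | apply: family_moduleK].
- by exists (@comonad_coreflective_family A n);
    [apply: coreflective_comonad_familyK | apply: comonad_coreflective_familyK].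
- by move=> M i; split=> // a; apply: arr_module_eps.
- by [].
Qed.
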